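(* Let $\mathcal H$ be a complex Hilbert space of finite dimension $d\ge 2$. For every nonzero orthogonal projection $P$ on $\mathcal H$, every nonempty profile class $\mathfrak M_{P,\lambda}$, and every context-indexed probability assignment $w$ on $\mathfrak M(\mathcal H)$, $$\operatorname{osc}_{P,\lambda}(w)=\operatorname{def}_{P,\lambda}(w).$$ Consequently, on maximal measurements, a context-indexed probability assignment $w$ is $\varepsilon$-context independent at each fixed outcome if and only if it is $\varepsilon$-invariant under all complementary unitaries; that is, for every $\varepsilon\ge 0$ and every context-indexed probability assignment $w$ on $\mathfrak M_1(\mathcal H)$, one has $|w(P,\mathsf M)-w(P,\mathsf N)|\le\varepsilon$ for every rank-one $P$ and all $\mathsf M,\mathsf N\in\mathfrak M_1(\mathcal H)$ containing $P$ if and only if $|w(P,U\mathsf MU^* )-w(P,\mathsf M)|\le\varepsilon$ for every rank-one $P$, every $\mathsf M\in\mathfrak M_1(\mathcal H)$ containing $P$, and every $U\in G_P$.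
   Context: A projective measurement on $\mathcal H$ is an unordered finite family (set) $\mathsf M=\{P_1,\dots,P_m\}$ of nonzero pairwise orthogonal orthogonal projections on $\mathcal H$ with $\sum_{j=1}^m P_j=I$; it is maximal if every $P_j$ has rank one. $\mathfrak M(\mathcal H)$ is the set of all projective measurements, $\mathfrak M_1(\mathcal H)$ the set of maximal ones, and $\mathfrak M_P=\{\mathsf M\in\mathfrak M(\mathcal H):P\in\mathsf M\}$. For $P\in\mathsf M$, the complementary rank profile $\lambda_P(\mathsf M)$ is the nondecreasing tuple listing (with multiplicity) the ranks of the projections in $\mathsf M\setminus\{P\}$, an integer partition of $d-\operatorname{rank}P$ (empty if $P=I$); $\mathfrak M_{P,\lambda}=\{\mathsf M\in\mathfrak M_P:\lambda_P(\mathsf M)=\lambda\}$. $G_P=\{U\in\mathcal U(\mathcal H):Ux=x\text{ for every }x\in\operatorname{ran}P\}$ (the complementary unitaries), where $\mathcal U(\mathcal H)$ is the unitary group, and $U\mathsf M U^*:=\{UQU^*:Q\in\mathsf M\}$. A context-indexed probability assignment on a class $\mathcal D\subseteq\mathfrak M(\mathcal H)$ is a function $w:\{(P,\mathsf M):\mathsf M\in\mathcal D,\ P\in\mathsf M\}\to[0,1]$ with $\sum_{P\in\mathsf M}w(P,\mathsf M)=1$ for every $\mathsf M\in\mathcal D$. For a nonempty $\mathfrak M_{P,\lambda}$, define $$\operatorname{osc}_{P,\lambda}(w)=\sup_{\mathsf M,\mathsf N\in\mathfrak M_{P,\lambda}}|w(P,\mathsf M)-w(P,\mathsf N)|,\qquad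 \operatorname{def}_{P,\lambda}(w)=\sup_{\mathsf M\in\mathfrak M_{P,\lambda},\,U\in G_P}|w(P,U\mathsf MU^* )-w(P,\mathsf M)|.$$ *)

(* Defs.v *)
From HB Require Import structures.
From mathcomp Require Import all_boot all_order all_algebra.
From mathcomp Require Import complex finmap.
From mathcomp Require Import boolp classical_sets reals.
Set Implicit Arguments.
Unset Strict Implicit.
Unset Printing Implicit Defensive.
Import Order.TTheory GRing.Theory Num.Theory.
Local Open Scope classical_set_scope.
Local Open Scope fset_scope.
Local Open Scope ring_scope.

(* A finite-dimensional complex Hilbert space is a vector space H over R[i]
   (R a model of the real numbers) with a positive definite Hermitian form dot,
   linear in its first argument; completeness is automatic. *)
Section Operators.
Variables (R : realType) (H : vectType R[i]) (dot : {dot H for Num.conj}).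
Implicit Types (A P Q U : 'End(H)) (M : {fset 'End(H)}).

(* The default value 0 is never used, by adjointP below. *)
Definition adjoint A : 'End(H) :=
  xget 0 [set B : 'End(H) | forall x y, dot (A x) y = dot x (B y)].

Lemma adjointP A x y : dot (A x) y = dot x (adjoint A y).
Proof.
suff : exists B : 'End(H), forall x y, dot (A x) y = dot x (B y).
  by rewrite /adjoint => /(xgetPex 0) /= ->.
pose e := vbasis {:H}.
have hC u v : dot u v = Num.conj (dot v u) by rewrite hermC expr0 mul1r.
have linT (G : 'End(H)) : linear (fun z => \row_(i < \dim {:H}) dot z (G e`_i)).
  by move=> a u v; apply/rowP=> i; rewrite !mxE linearPl.
pose mT (G : 'End(H)) : {linear H -> 'rV[R[i]]_(\dim {:H})} := HB.pack
  (fun z => \row_i dot z (G e`_i))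
  (GRing.isLinear.Build _ _ _ _ _ (linT G)).
pose T := linfun (mT \1%VF); pose S := linfun (mT A).
have kerT : lker T == 0%VS.
  apply/eqP/vspaceP=> z; rewrite memv_ker memv0; apply/eqP/eqP=> [|->]; last first.
    by rewrite linear0.
  rewrite lfunE /= => /rowP Tz; apply/eqP; rewrite -(dnorm_eq0 dot).
  rewrite {2}(coord_vbasis (memvf z)) linear_sumr big1 // => i _.
  rewrite linearZr /=; move/(_ i): Tz; rewrite !mxE lfunE /= => ->.
  by rewrite mulr0.
have limT : limg T = fullv.
  apply/eqP; rewrite eqEdim subvf /= limg_dim_eq ?(eqP kerT) ?capv0 //.
  by rewrite dimvf /dim /= mul1n.
exists (T^-1 \o S)%VF => {}x {}y; rewrite comp_lfunE.
have TB : T (T^-1%VF (S y)) = S y.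
  by apply: limg_lfunVK; rewrite limT memvf.
set z := T^-1%VF (S y) in TB *.
rewrite {1 2}(coord_vbasis (memvf x)) linear_sum !linear_sumlz.
apply: eq_bigr => i _; rewrite linearZ !linearZl /=; congr (_ * _).
move: TB; rewrite !lfunE /= => /rowP/(_ i); rewrite !mxE lfunE /= => TB.
by rewrite [LHS]hC [RHS]hC TB.
Qed.

Definition orth_projection P := (P \o P)%VF = P /\ adjoint P = P.

Definition unitary U :=
  (adjoint U \o U)%VF = \1%VF /\ (U \o adjoint U)%VF = \1%VF.

Definition rank P : nat := \dim (limg P).

Definition proj_measurement : set {fset 'End(H)} := [set M : {fset 'End(H)} |
  [/\ forall P, P \in M -> orth_projection P /\ P != 0,
      forall P Q, P \in M -> Q \in M -> P != Q -> (P \o Q)%VF = 0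
    & \sum_(P <- M) P = \1%VF]].

Definition maximal_measurement : set {fset 'End(H)} :=
  proj_measurement `&` [set M : {fset 'End(H)} | forall P, P \in M -> rank P = 1%N].

Definition comp_rank_profile P M : seq nat :=
  sort leq [seq rank Q | Q <- (M `\ P)%fset].

Definition profile_class P (lam : seq nat) : set {fset 'End(H)} := [set M : {fset 'End(H)} |
  [/\ proj_measurement M, P \in M & comp_rank_profile P M = lam]].

Definition comp_unitary P : set 'End(H) :=
  [set U : 'End(H) | unitary U /\ forall x, x \in limg P -> U x = x].

Definition conj_measurement U M : {fset 'End(H)} :=
  [fset (U \o Q \o adjoint U)%VF | Q in M]%fset.

(* w P M stands for w(P, M) and is only constrained, and only ever used, for
   M in D and P in M. *)
Definition prob_assignment (D : set {fset 'End(H)})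
    (w : 'End(H) -> {fset 'End(H)} -> R) : Prop :=
  forall M, D M ->
    (forall P, P \in M -> 0 <= w P M <= 1) /\ \sum_(P <- M) w P M = 1.

(* On a nonempty profile class, and for w a probability assignment on all
   projective measurements, both sets below are nonempty and bounded by 1, so
   that sup is the true supremum. *)
Definition osc P lam (w : 'End(H) -> {fset 'End(H)} -> R) : R :=
  sup [set `|w P M - w P N| | M in profile_class P lam
                            & N in profile_class P lam].

Definition defect P lam (w : 'End(H) -> {fset 'End(H)} -> R) : R :=
  sup [set `|w P (conj_measurement U M) - w P M|
        | M in profile_class P lam & U in comp_unitary P].

Definition eps_context_independent (eps : R)
    (w : 'End(H) -> {fset 'End(H)} -> R) : Prop :=
  forall P, orth_projection P -> rank P = 1%N ->
  forall M N, maximal_measurement M -> P \in M ->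
              maximal_measurement N -> P \in N ->
  `|w P M - w P N| <= eps.

Definition eps_invariant (eps : R)
    (w : 'End(H) -> {fset 'End(H)} -> R) : Prop :=
  forall P, orth_projection P -> rank P = 1%N ->
  forall M, maximal_measurement M -> P \in M ->
  forall U, comp_unitary P U ->
  `|w P (conj_measurement U M) - w P M| <= eps.

End Operators.

(* Main.v *)
(* Both claims hold because the group G_P acts on the class of measurements
   containing P with profile lambda, and acts transitively on it: two
   measurements of the class can be matched projection by projection with equal
   ranks, and equal-rank orthogonal projections are the initial and final
   projections of a partial isometry. All maximal measurements containing P
   have the same profile (1, ..., 1). *)
From HB Require Import structures.
Require Import Defs.
From mathcomp Require Import all_boot all_order all_algebra.
From mathcomp Require Import complex finmap.
From mathcomp Require Import boolp classical_sets reals.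
Set Implicit Arguments.
Unset Strict Implicit.
Unset Printing Implicit Defensive.
Local Open Scope classical_set_scope.
Local Open Scope ring_scope.
Import Order.TTheory GRing.Theory Num.Theory.

Section Hilbert.
Variables (R : realType) (H : vectType R[i]) (dot : {dot H for Num.conj}).
Implicit Types (A B P Q U V : 'End(H)) (M N : {fset 'End(H)}).
Local Notation adj := (adjoint dot).
Local Notation rank := (@rank R H).
Local Notation orth_projection := (orth_projection dot).
Local Notation unitary := (unitary dot).

(** * Adjoint calculus and rank-one operators *)

Lemma dotC u v : dot u v = Num.conj (dot v u).
Proof. by rewrite hermC expr0 mul1r. Qed.

Lemma eq_dotr u v : (forall x, dot x u = dot x v) -> u = v.
Proof.
by move=> uv; apply/subr0_eq/eqP; rewrite -(dnorm_eq0 dot) linearBr /= uv subrr.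
Qed.

(** Nondegeneracy of [dot] pins down the operator chosen by [xget]; the formulas for adjoints below
    are all obtained this way. *)
Lemma adjoint_unique A B :
  (forall x y, dot (A x) y = dot x (B y)) -> adj A = B.
Proof.
by move=> AB; apply/lfunP=> y; apply: eq_dotr => x; rewrite -adjointP AB.
Qed.

Lemma adjointK : involutive adj.
Proof.
by move=> A; apply: adjoint_unique => x y; rewrite dotC -adjointP -dotC.
Qed.

Lemma adjoint_comp A B : adj (A \o B)%VF = (adj B \o adj A)%VF.
Proof.
by apply: adjoint_unique => x y; rewrite !comp_lfunE !adjointP.
Qed.

Lemma adjointB A B : adj (A - B) = adj A - adj B.
Proof.
apply: adjoint_unique => x y; rewrite !(add_lfunE, opp_lfunE).
by rewrite linearBl linearBr /= !adjointP.
Qed.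

Lemma adjoint_sum I (r : seq I) (F : I -> 'End(H)) :
  adj (\sum_(i <- r) F i) = \sum_(i <- r) adj (F i).
Proof.
apply: adjoint_unique => x y; rewrite !sum_lfunE linear_sumr linear_sumlz /=.
by apply: eq_bigr => i _; rewrite adjointP.
Qed.

Definition ketbra_fun (u v x : H) : H := dot x v *: u.

Lemma ketbra_fun_is_linear u v : linear (ketbra_fun u v).
Proof. by move=> a x y; rewrite /ketbra_fun linearPl scalerDl scalerA. Qed.

HB.instance Definition _ u v :=
  GRing.isLinear.Build _ _ _ _ _ (@ketbra_fun_is_linear u v).

(** In Dirac notation this is $|u\rangle\langle v|$; [v] sits in the second slot of [dot], the
    conjugate-linear one. *)
Definition ketbra u v : 'End(H) := linfun (ketbra_fun u v).

Lemma ketbraE u v x : ketbra u v x = dot x v *: u.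
Proof. by rewrite lfunE. Qed.

Lemma adjoint_ketbra u v : adj (ketbra u v) = ketbra v u.
Proof.
apply: adjoint_unique => x y; rewrite !ketbraE linearZl linearZr /=.
by rewrite -dotC mulrC.
Qed.

Lemma comp_ketbra u v x y :
  (ketbra u v \o ketbra x y)%VF = dot x v *: ketbra u y.
Proof.
apply/lfunP=> z; rewrite comp_lfunE scale_lfunE !ketbraE linearZl /=.
by rewrite scalerA mulrC.
Qed.

Lemma comp_suml I (r : seq I) (F : I -> 'End(H)) A :
  ((\sum_(i <- r) F i) \o A)%VF = \sum_(i <- r) (F i \o A)%VF.
Proof.
by apply/lfunP=> x; rewrite comp_lfunE !sum_lfunE; apply: eq_bigr => i _;
  rewrite comp_lfunE.
Qed.

Lemma comp_sumr I (r : seq I) (F : I -> 'End(H)) A :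
  (A \o \sum_(i <- r) F i)%VF = \sum_(i <- r) (A \o F i)%VF.
Proof.
apply/lfunP=> x; rewrite comp_lfunE !sum_lfunE linear_sum.
by apply: eq_bigr => i _; rewrite comp_lfunE.
Qed.

(** * Ranks of idempotents and orthonormal bases of their ranges *)

Lemma idem_limgP P x : (P \o P)%VF = P -> reflect (P x = x) (x \in limg P).
Proof.
move=> PP; apply: (iffP memv_imgP) => [[y _ ->]|<-].
  by rewrite -comp_lfunE PP.
by exists x; rewrite ?memvf.
Qed.

(** Each idempotent kills the range of the other, so the two ranges meet only in 0 and [A + B] acts
    as the identity on both: its range is their direct sum. *)
Lemma rank_add_idem A B :
  (A \o A)%VF = A -> (B \o B)%VF = B -> (A \o B)%VF = 0 -> (B \o A)%VF = 0 ->
  rank (A + B) = (rank A + rank B)%N.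
Proof.
move=> AA BB AB BA; rewrite /Defs.rank -dimv_disjoint_sum; last first.
  apply/eqP; rewrite -subv0; apply/subvP=> x; rewrite memv_cap memv0.
  case/andP=> /(idem_limgP _ AA) Ax /(idem_limgP _ BB) Bx.
  by rewrite -Ax -Bx -comp_lfunE AB zero_lfunE.
congr (\dim _); apply/eqP; rewrite eqEsubv; apply/andP; split.
  apply/subvP=> _ /memv_imgP[x _ ->]; rewrite add_lfunE.
  by rewrite memv_add ?memv_img ?memvf.
apply/subvP=> _ /memv_addP[x xA [y yB ->]].
move: xA yB => /(idem_limgP _ AA) Ax /(idem_limgP _ BB) By.
apply/memv_imgP; exists (x + y); rewrite ?memvf //.
have Ay : A y = 0 by rewrite -By -comp_lfunE AB zero_lfunE.
have Bx : B x = 0 by rewrite -Ax -comp_lfunE BA zero_lfunE.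
by rewrite add_lfunE !linearD /= Ax By Ay Bx addr0 add0r.
Qed.

Lemma rank_sum_idem (s : seq 'End(H)) : uniq s ->
  (forall P, P \in s -> (P \o P)%VF = P) ->
  (forall P Q, P \in s -> Q \in s -> P != Q -> (P \o Q)%VF = 0) ->
  rank (\sum_(P <- s) P) = (\sum_(P <- s) rank P)%N.
Proof.
elim: s => [|P s IHs] /=.
  rewrite !big_nil => _ _ _; apply/eqP; rewrite dimv_eq0 -lkerE.
  by apply/subvP=> x _; rewrite memv_ker zero_lfunE.
case/andP=> Ps us idem orth; rewrite !big_cons.
have PQ Q : Q \in s -> P != Q by apply: contraTneq => <-.
have PS : P \in P :: s by rewrite mem_head.
have sS Q : Q \in s -> Q \in P :: s by rewrite inE orbC => ->.
rewrite rank_add_idem; first congr addn; first last.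
- by rewrite comp_suml big_seq big1 // => Q Qs; rewrite (orth _ _ (sS _ Qs) PS) // eq_sym PQ.
- by rewrite comp_sumr big_seq big1 // => Q Qs; rewrite (orth _ _ PS (sS _ Qs)) ?PQ.
(* The remaining sum is idempotent: in the row of [Q] of the double sum only the diagonal term
   survives. *)
- rewrite comp_suml [LHS]big_seq [RHS]big_seq; apply: eq_bigr => Q Qs.
  rewrite comp_sumr (big_rem Q) //= idem ?sS // big_seq big1 ?addr0 // => Q'.
  rewrite mem_rem_uniq // inE => /andP[Q'Q Q's].
  by rewrite orth ?sS // eq_sym.
- exact: idem.
by apply: IHs => // [Q /sS|Q Q' /sS Qs /sS]; [apply: idem | apply: orth].
Qed.

Lemma rank_ketbra u v : u != 0 -> v != 0 -> rank (ketbra u v) = 1%N.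
Proof.
move=> u0 v0; suff -> : Defs.rank (ketbra u v) = \dim <[u]>.
  by rewrite dim_vline u0.
congr (\dim _); apply/eqP; rewrite eqEsubv; apply/andP; split.
  by apply/subvP=> _ /memv_imgP[x _ ->]; rewrite ketbraE memvZ ?memv_line.
apply/subvP=> _ /vlineP[a ->]; apply/memv_imgP.
(* Dividing by [dot v v] makes the coefficient of [u] exactly [a]. *)
exists ((a / dot v v) *: v); rewrite ?memvf // ketbraE linearZl /=.
by rewrite divfK // dnorm_eq0.
Qed.

(** Induction on the rank: split off a unit vector [u] of the range; [Q - ketbra u u] is again an
    orthogonal projection, of rank one less. *)
Lemma orth_projection_onb n Q : orth_projection Q -> rank Q = n ->
  exists e : 'I_n -> H, (forall i j, dot (e i) (e j) = (i == j)%:R) /\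
    Q = \sum_i ketbra (e i) (e i).
Proof.
elim: n Q => [|n IHn] Q [QQ Qadj] rQ.
  exists (fun=> 0); split=> [[]//|]; rewrite big_ord0.
  apply/lfunP=> x; rewrite zero_lfunE; apply/eqP; rewrite -memv0.
  by move/eqP: rQ; rewrite /Defs.rank dimv_eq0 => /eqP <-; rewrite memv_img ?memvf.
have [u Qu uu] : exists2 u, Q u = u & dot u u = 1.
  pose x := vpick (limg Q).
  have x0 : x != 0 by rewrite vpick0 -dimv_eq0 -/(Defs.rank Q) rQ.
  exists ((sqrtC (dot x x))^-1 *: x).
    by apply/(idem_limgP _ QQ); rewrite memvZ ?memv_pick.
  rewrite dnormZ normfV exprVn ger0_norm ?sqrt_dnorm_ge0 // sqrtCK mulVf //.
  by rewrite dnorm_eq0.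
have u0 : u != 0.
  by apply: contra_eq_neq uu => ->; rewrite linear0r eq_sym oner_neq0.
pose K := ketbra u u.
have KK : (K \o K)%VF = K by rewrite comp_ketbra uu scale1r.
have Kadj : adj K = K by rewrite adjoint_ketbra.
have QK : (Q \o K)%VF = K.
  by apply/lfunP=> x; rewrite comp_lfunE !ketbraE linearZ /= Qu.
have KQ : (K \o Q)%VF = K by rewrite -Kadj -{1}Qadj -adjoint_comp QK.
pose Q1 := Q - K.
have KQ1 : (K \o Q1)%VF = 0 by rewrite comp_lfunDr comp_lfunNr KQ KK subrr.
have Q1K : (Q1 \o K)%VF = 0 by rewrite comp_lfunDl comp_lfunNl QK KK subrr.
have Q1adj : adj Q1 = Q1 by rewrite adjointB Qadj Kadj.
have Q1Q1 : (Q1 \o Q1)%VF = Q1.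
  by rewrite {1}/Q1 comp_lfunDl comp_lfunNl KQ1 oppr0 addr0 comp_lfunDr
             comp_lfunNr QQ QK.
have [|e [ee Q1E]] := IHn Q1 (conj Q1Q1 Q1adj).
  have : Q = K + Q1 by rewrite addrC subrK.
  move/(congr1 rank); rewrite rank_add_idem // rank_ketbra // rQ add1n.
  by case.
(* [Q1] is self-adjoint, fixes every [e i] and kills [u], which makes [u] orthogonal to the basis
   given by induction. *)
have Q1e i : Q1 (e i) = e i.
  rewrite Q1E sum_lfunE (bigD1 i) //= ketbraE ee eqxx scale1r big1 ?addr0 //.
  by move=> j /negPf ji; rewrite ketbraE ee eq_sym ji scale0r.
have Q1u : Q1 u = 0 by rewrite add_lfunE opp_lfunE Qu ketbraE uu scale1r subrr.
have ue i : dot u (e i) = 0 by rewrite -Q1e -{1}Q1adj -adjointP Q1u linear0l.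
have eu i : dot (e i) u = 0 by rewrite dotC ue rmorph0.
exists (fun i => if unlift ord0 i is Some j then e j else u); split.
  move=> i j /=.
  case: (unliftP ord0 i) => [i'|] ->; case: (unliftP ord0 j) => [j'|] ->;
    by rewrite ?liftK ?unlift_none ?ee ?(inj_eq lift_inj).
rewrite big_ord_recl unlift_none.
rewrite (eq_bigr (fun i => ketbra (e i) (e i))); last by move=> i _; rewrite liftK.
by rewrite -Q1E addrC subrK.
Qed.

(** * Sums of partial isometries with pairwise orthogonal initial and final projections *)

Section SumPartialIsometries.
Variables (n : nat) (V : 'I_n -> 'End(H)).
Hypothesis V_pisom : forall i, (V i \o adj (V i) \o V i)%VF = V i.
Hypothesis V_init : forall i j, i != j ->
  ((adj (V i) \o V i) \o (adj (V j) \o V j))%VF = 0.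
Hypothesis V_fin : forall i j, i != j ->
  ((V i \o adj (V i)) \o (V j \o adj (V j)))%VF = 0.

Let adj_pisom i : (adj (V i) \o V i \o adj (V i))%VF = adj (V i).
Proof. by rewrite -{4}(V_pisom i) !adjoint_comp adjointK comp_lfunA. Qed.

(** A partial isometry absorbs its final projection on the left; inserting both final projections
    puts their zero product in the middle. *)
Let adjVV i j : i != j -> (adj (V i) \o V j)%VF = 0.
Proof.
move=> ij; rewrite -(V_pisom j) -(adj_pisom i).
suff -> : (adj (V i) \o V i \o adj (V i) \o (V j \o adj (V j) \o V j))%VF =
  (adj (V i) \o ((V i \o adj (V i)) \o (V j \o adj (V j))) \o V j)%VF.
  by rewrite V_fin // comp_lfun0r comp_lfun0l.
by rewrite !comp_lfunA.
Qed.

Let VadjV i j : i != j -> (V i \o adj (V j))%VF = 0.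
Proof.
move=> ij; rewrite -(V_pisom i) -(adj_pisom j).
suff -> : (V i \o adj (V i) \o V i \o (adj (V j) \o V j \o adj (V j)))%VF =
  (V i \o ((adj (V i) \o V i) \o (adj (V j) \o V j)) \o adj (V j))%VF.
  by rewrite V_init // comp_lfun0r comp_lfun0l.
by rewrite !comp_lfunA.
Qed.

Let W := \sum_i V i.

Lemma sum_pisom_comp_adj i : (W \o adj (V i))%VF = (V i \o adj (V i))%VF.
Proof.
rewrite comp_suml (bigD1 i) //= big1 ?addr0 // => j ji.
exact: VadjV.
Qed.

Lemma adj_comp_sum_pisom i : (adj (V i) \o W)%VF = (adj (V i) \o V i)%VF.
Proof.
rewrite comp_sumr (bigD1 i) //= big1 ?addr0 // => j ji.
by rewrite adjVV // eq_sym.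
Qed.

Lemma sum_pisom_init : (adj W \o W)%VF = \sum_i (adj (V i) \o V i)%VF.
Proof.
rewrite adjoint_sum comp_suml; apply: eq_bigr => i _.
exact: adj_comp_sum_pisom.
Qed.

Lemma sum_pisom_fin : (W \o adj W)%VF = \sum_i (V i \o adj (V i))%VF.
Proof.
rewrite adjoint_sum comp_sumr; apply: eq_bigr => i _.
exact: sum_pisom_comp_adj.
Qed.

(** The sum agrees with [V i] on the initial space of [V i]. This is what later shows that the
    constructed unitary fixes the range of [P]. *)
Lemma sum_pisom_comp_init i : (W \o (adj (V i) \o V i))%VF = V i.
Proof. by rewrite comp_lfunA sum_pisom_comp_adj V_pisom. Qed.

Lemma sum_pisom : (W \o adj W \o W)%VF = W.
Proof.
rewrite -comp_lfunA sum_pisom_init comp_sumr; apply: eq_bigr => i _.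
exact: sum_pisom_comp_init.
Qed.

Lemma sum_pisom_conj i :
  (W \o (adj (V i) \o V i) \o adj W)%VF = (V i \o adj (V i))%VF.
Proof.
rewrite sum_pisom_comp_init -{1}[V i]adjointK -adjoint_comp.
by rewrite sum_pisom_comp_adj adjoint_comp adjointK.
Qed.

End SumPartialIsometries.

(** Send an orthonormal basis [e] of the range of [P] to one, [f], of the range of [Q]: the
    operators [ketbra (f i) (e i)] are partial isometries to which the results on sums apply. *)
Lemma exists_pisom P Q :
  orth_projection P -> orth_projection Q -> rank P = rank Q ->
  exists V, [/\ (V \o adj V \o V)%VF = V, (adj V \o V)%VF = P
    & (V \o adj V)%VF = Q].
Proof.
move=> Pproj Qproj PQ.
(* Through [PQ] the basis for [P] is indexed by ['I_(rank Q)], like the one for [Q]. *)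
have [e [ee Pe]] := orth_projection_onb Pproj PQ.
have [f [ff Qf]] := orth_projection_onb Qproj erefl.
pose V i := ketbra (f i) (e i).
have Vi i : (adj (V i) \o V i)%VF = ketbra (e i) (e i).
  by rewrite adjoint_ketbra comp_ketbra ff eqxx scale1r.
have Vf i : (V i \o adj (V i))%VF = ketbra (f i) (f i).
  by rewrite adjoint_ketbra comp_ketbra ee eqxx scale1r.
have VV i : (V i \o adj (V i) \o V i)%VF = V i.
  by rewrite Vf comp_ketbra ff eqxx scale1r.
have orth_i i j : i != j ->
    ((adj (V i) \o V i) \o (adj (V j) \o V j))%VF = 0.
  by rewrite eq_sym !Vi comp_ketbra ee => /negPf ->; rewrite scale0r.
have orth_f i j : i != j ->
    ((V i \o adj (V i)) \o (V j \o adj (V j)))%VF = 0.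
  by rewrite eq_sym !Vf comp_ketbra ff => /negPf ->; rewrite scale0r.
exists (\sum_i V i); split; first exact: sum_pisom.
  by apply: etrans (esym Pe); rewrite sum_pisom_init //; apply: eq_bigr.
by apply: etrans (esym Qf); rewrite sum_pisom_fin //; apply: eq_bigr.
Qed.

(** * Unitary conjugation of projections and measurements *)

Lemma rank_comp_leql A B : (rank (A \o B)%VF <= rank A)%N.
Proof. by rewrite /Defs.rank limg_comp dimvS // limgS ?subvf. Qed.

Lemma rank_comp_leqr A B : (rank (A \o B)%VF <= rank B)%N.
Proof.
by rewrite /Defs.rank limg_comp -[X in (_ <= X)%N](limg_ker_dim A) leq_addl.
Qed.

Section UnitaryConjugation.
Variable U : 'End(H).
Hypothesis Uunitary : unitary U.
Let conjU Q := (U \o Q \o adj U)%VF.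

Lemma unitary_conjK : cancel conjU (fun Q => (adj U \o Q \o U)%VF).
Proof.
case: Uunitary => UU _ Q.
rewrite /conjU !comp_lfunA UU comp_lfun1l -comp_lfunA UU.
exact: comp_lfun1r.
Qed.

Lemma unitary_conj_comp P Q : (conjU P \o conjU Q)%VF = conjU (P \o Q)%VF.
Proof.
case: Uunitary => UU _; rewrite /conjU !comp_lfunA.
by rewrite -(comp_lfunA _ (adj U) U) UU comp_lfun1r.
Qed.

(** Composition never increases rank, and [Q] is recovered from its conjugate by composition. *)
Lemma rank_unitary_conj Q : rank (conjU Q) = rank Q.
Proof.
apply/eqP; rewrite eqn_leq; apply/andP; split.
  exact: leq_trans (rank_comp_leql _ _) (rank_comp_leqr _ _).
rewrite -{1}[Q]unitary_conjK.
exact: leq_trans (rank_comp_leql _ _) (rank_comp_leqr _ _).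
Qed.

Lemma orth_projection_conj Q : orth_projection Q -> orth_projection (conjU Q).
Proof.
case=> QQ Qadj; split; first by rewrite unitary_conj_comp QQ.
by rewrite !adjoint_comp adjointK Qadj comp_lfunA.
Qed.

Lemma proj_measurement_conj M :
  proj_measurement dot M -> proj_measurement dot (conj_measurement dot U M).
Proof.
case=> proj orth sum1; have inj := can_inj unitary_conjK.
split.
- move=> _ /imfsetP[Q /= /proj[Qp Q0] ->]; split.
    exact: orth_projection_conj.
  apply: contra_neq Q0 => cQ; apply: inj.
  by rewrite /conjU cQ comp_lfun0r comp_lfun0l.
- move=> _ _ /imfsetP[P /= PM ->] /imfsetP[Q /= QM ->] PQ.
  rewrite unitary_conj_comp orth //; last by apply: contra_neq PQ => ->.
  by rewrite /conjU comp_lfun0r comp_lfun0l.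
- rewrite big_imfset /=; last by move=> P Q _ _; apply: inj.
  by rewrite -comp_suml -comp_sumr sum1 comp_lfun1r; case: Uunitary.
Qed.

(** Conjugation is injective and fixes [P], so it maps the complement of [P] in [M] onto that in the
    conjugated measurement, preserving ranks. Sorting removes the dependence on the enumeration of
    the sets. *)
Lemma comp_rank_profile_conj P M : conjU P = P ->
  comp_rank_profile P (conj_measurement dot U M) = comp_rank_profile P M.
Proof.
move=> cP; have inj := can_inj unitary_conjK; rewrite /comp_rank_profile.
have -> : (conj_measurement dot U M `\ P = conjU @` (M `\ P))%fset.
  apply/fsetP=> Q; rewrite !inE; apply/andP/imfsetP => [[QP /imfsetP[Q' /= Q'M QE]]|].
    exists Q' => //=; rewrite !inE Q'M andbT.
    by apply: contra_neq QP => Q'P; rewrite QE Q'P.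
  case=> Q' /=; rewrite !inE => /andP[Q'P Q'M] ->; split.
    by apply: contra_neq Q'P; rewrite -{1}cP; apply: inj.
  by apply/imfsetP; exists Q'.
apply/perm_sortP; [exact: leq_total|exact: leq_trans|exact: anti_leq|].
apply: perm_trans (perm_map _ (enum_imfset _ _)) _.
  by move=> ? ? _ _; apply: inj.
by rewrite -map_comp; under eq_map do rewrite /= rank_unitary_conj.
Qed.

End UnitaryConjugation.

(** * The action of the complementary unitaries on profile classes *)

Lemma comp_unitary_conj P U :
  orth_projection P -> comp_unitary dot P U -> (U \o P \o adj U)%VF = P.
Proof.
case=> PP Padj [Uu Ufix].
have UP : (U \o P)%VF = P.
  by apply/lfunP=> x; rewrite comp_lfunE Ufix // memv_img ?memvf.
(* The adjoint of $UP = P$ is $PU^* = P$. *)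
by rewrite UP -{1}Padj -adjoint_comp UP.
Qed.

Lemma profile_class_conj P lam M U :
  profile_class dot P lam M -> comp_unitary dot P U ->
  profile_class dot P lam (conj_measurement dot U M).
Proof.
move=> [Mm PM <-] UP; have [proj _ _] := Mm; have [Pp _] := proj _ PM.
have cP := comp_unitary_conj Pp UP; have [Uu _] := UP; split.
- exact: proj_measurement_conj.
- by apply/imfsetP; exists P.
- exact: comp_rank_profile_conj.
Qed.

Lemma maximal_measurement_conj M U : unitary U ->
  maximal_measurement dot M -> maximal_measurement dot (conj_measurement dot U M).
Proof.
move=> Uu [Mm M1]; split; first exact: proj_measurement_conj.
by move=> _ /imfsetP[Q /= /M1 Q1 ->]; rewrite rank_unitary_conj.
Qed.

(** * Transitivity of the action *)

Lemma perm_fsetD1 (K : choiceType) (x : K) (X : {fset K}) :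
  x \in X -> perm_eq (x :: (X `\ x)%fset) X.
Proof.
move=> xX; apply: uniq_perm; rewrite ?fset_uniq //=.
  by rewrite fset_uniq !inE eqxx.
by move=> y; rewrite !inE; case: eqVneq => // ->.
Qed.

(** The ranks in a measurement add up to that of the identity, so there are [\dim {:H}] projections
    of rank one, and removing [P] leaves one fewer. *)
Lemma maximal_comp_rank_profile P M : maximal_measurement dot M -> P \in M ->
  comp_rank_profile P M = nseq (\dim {:H}).-1 1%N.
Proof.
move=> [[proj orth sum1] M1] PM; rewrite /comp_rank_profile.
have sizeM : size M = \dim {:H}.
  have := rank_sum_idem (fset_uniq M) (fun Q QM => (proj Q QM).1.1) orth.
  rewrite sum1 (eq_big_seq (fun=> 1%N)) // sum1_size => <-.
  by rewrite /Defs.rank lim1g.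
have : all (pred1 1%N) (sort leq [seq rank Q | Q <- (M `\ P)%fset]).
  rewrite all_sort all_map; apply/allP=> Q; rewrite !inE => /andP[_ QM] /=.
  by rewrite M1.
move/all_pred1P=> ->; rewrite size_sort size_map -sizeM.
by rewrite -(perm_size (perm_fsetD1 PM)).
Qed.

(* Sorting both complements by rank pairs their elements into projections of
   equal rank. The sum of partial isometries between paired projections, P
   itself being paired with P, is the required unitary. *)
Lemma exists_comp_unitary P M N :
  proj_measurement dot M -> P \in M -> proj_measurement dot N -> P \in N ->
  comp_rank_profile P M = comp_rank_profile P N ->
  exists2 U, comp_unitary dot P U & conj_measurement dot U M = N.
Proof.
move=> [Mproj Morth Msum] PM [Nproj Northo Nsum] PN.
rewrite /comp_rank_profile !sort_map => rankMN.
(* Putting [P] in front, outside the sorting, pairs it with itself at index 0. *)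
pose sorted_by_rank (K : {fset 'End(H)}) := P :: sort (relpre rank leq) (K `\ P)%fset.
have perm_sbr K : P \in K -> perm_eq (sorted_by_rank K) K.
  by move=> PK; apply: perm_trans (perm_fsetD1 PK); rewrite perm_cons perm_sort.
pose s := sorted_by_rank M; pose t := sorted_by_rank N.
have rank_st : map rank s = map rank t by rewrite /= rankMN.
have size_st : size t = size s by rewrite -(size_map rank t) -rank_st size_map.
have sM := perm_sbr _ PM; have tN := perm_sbr _ PN.
rewrite -/s -/t in sM tN.
pose p (i : 'I_(size s)) := nth 0 s i; pose q (i : 'I_(size s)) := nth 0 t i.
have pM i : p i \in M by rewrite -(perm_mem sM) mem_nth.
have qN i : q i \in N by rewrite -(perm_mem tN) mem_nth // size_st.
have p_inj : injective p.
  move=> i j /eqP; rewrite nth_uniq ?(perm_uniq sM) //; last exact: fset_uniq.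
  by move/eqP/val_inj.
have q_inj : injective q.
  move=> i j /eqP; rewrite nth_uniq ?size_st ?(perm_uniq tN) //; last exact: fset_uniq.
  by move/eqP/val_inj.
have pq i : rank (p i) = rank (q i).
  by rewrite -(nth_map _ 0%N) // rank_st (nth_map 0) // size_st.
(* The last clause matters at index 0: a general partial isometry from [P] to [P] could move vectors
   inside the range of [P], whereas [P] itself fixes them. *)
have Vex i : exists V, [/\ (V \o adj V \o V)%VF = V, (adj V \o V)%VF = p i,
    (V \o adj V)%VF = q i & p i = q i -> V = p i].
  have [Pp _] := Mproj _ (pM i); have [Qp _] := Nproj _ (qN i).
  have [pqi|/eqP pqi] := eqVneq (p i) (q i).
    by case: Pp => PP Padj; exists (p i); rewrite Padj !PP -pqi.
  by have [V [VV Vp Vq]] := exists_pisom Pp Qp (pq i); exists V.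
have [V VE] := choice Vex.
have [V_pisom V_init V_fin V_id] : [/\ forall i, (V i \o adj (V i) \o V i)%VF = V i,
  forall i, (adj (V i) \o V i)%VF = p i, forall i, (V i \o adj (V i))%VF = q i
  & forall i, p i = q i -> V i = p i].
  by split=> i; case: (VE i).
pose U := \sum_i V i.
have Vi i j : i != j -> ((adj (V i) \o V i) \o (adj (V j) \o V j))%VF = 0.
  by move=> ij; rewrite !V_init Morth // (inj_eq p_inj).
have Vf i j : i != j -> ((V i \o adj (V i)) \o (V j \o adj (V j)))%VF = 0.
  by move=> ij; rewrite !V_fin Northo // (inj_eq q_inj).
have sum_nth (l : seq 'End(H)) : size l = size s ->
    \sum_(i < size s) nth 0 l i = \sum_(Q <- l) Q.
  by move=> sl; rewrite [RHS](big_nth 0) big_mkord sl.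
have Uconj i : (U \o p i \o adj U)%VF = q i.
  by rewrite -V_init sum_pisom_conj // V_fin.
exists U; first split; first split.
- rewrite sum_pisom_init // (eq_bigr p) //.
  by rewrite sum_nth // (perm_big _ sM).
- rewrite sum_pisom_fin // (eq_bigr q) //.
  by rewrite sum_nth // (perm_big _ tN).
(* At index 0 both [p] and [q] are [P], so [V] is [P] there and $UP = P$. *)
- have [[PP _] _] := Mproj _ PM; move=> x /(idem_limgP _ PP) Px.
  pose i0 : 'I_(size s) := ord0.
  have := sum_pisom_comp_init V_pisom Vi i0.
  rewrite V_init V_id // => /lfunP/(_ x); rewrite comp_lfunE.
  by rewrite /p /= Px.
apply/fsetP=> Q; apply/imfsetP/idP => [[Q' /= Q'M ->]|QN].
  move: Q'M; rewrite -(perm_mem sM) => /(nthP 0)[i si <-].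
  by rewrite -/(p (Ordinal si)) Uconj.
move: QN; rewrite -(perm_mem tN) => /(nthP 0)[i ti <-]; have si := ti.
rewrite size_st in si.
by exists (p (Ordinal si)); rewrite //= Uconj.
Qed.

End Hilbert.

Theorem proposition4p5 (R : realType) (H : vectType R[i])
    (dot : {dot H for Num.conj}) (hd : (2 <= \dim {:H})%N) :
  (forall (P : 'End(H)) (lam : seq nat) (w : 'End(H) -> {fset 'End(H)} -> R),
     orth_projection dot P -> P != 0 ->
     profile_class dot P lam !=set0 ->
     prob_assignment (proj_measurement dot) w ->
     osc dot P lam w = defect dot P lam w)
  /\
  (forall (eps : R) (w : 'End(H) -> {fset 'End(H)} -> R),
     0 <= eps ->
     prob_assignment (maximal_measurement dot) w ->
     eps_context_independent dot eps w <-> eps_invariant dot eps w).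

Proof.
split.
  (* The suprema agree because the two sets of values are equal: transitivity gives one inclusion,
     stability of the class under the action the other. *)
  move=> P lam w Pproj _ _ _; congr sup; apply/seteqP; split=> r.
    move=> [M [Mm PM Mlam] [N [Nm PN Nlam] <-]].
    have [U UP UM] := exists_comp_unitary Mm PM Nm PN (etrans Mlam (esym Nlam)).
    by exists M => //; exists U => //; rewrite UM distrC.
  move=> [M Mlam [U UP <-]]; exists (conj_measurement dot U M).
    exact: profile_class_conj.
  by exists M.
move=> eps w _ _; split=> [indep P Pp rP M Mm PM U UP|inv P Pp rP M N Mm PM Nm PN].
  have cP := comp_unitary_conj Pp UP; have [Uu _] := UP.
  apply: (indep P) => //; first exact: maximal_measurement_conj.
  by apply/imfsetP; exists P.
(* The two profiles coincide by maximality, so [N] is a conjugate of [M] by a complementary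
   unitary. *)
have [|U UP <-] := exists_comp_unitary Mm.1 PM Nm.1 PN.
  by rewrite (maximal_comp_rank_profile Mm PM) (maximal_comp_rank_profile Nm PN).
by rewrite distrC; apply: inv.
Qed.
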